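(* Let $P$ and $Q$ be finite series-parallel posets with $K_P(\mathbf{x})=K_Q(\mathbf{x})$. Then $P$ and $Q$ are isomorphic. (That is, a series-parallel poset is uniquely determined up to isomorphism by its $P$-partition generating function.)
   Context: For a finite poset $(P,\preceq)$, a $P$-partition is a map $\theta\colon P\to\mathbb{Z}^+$ with $\theta(x)\le\theta(y)$ whenever $x\preceq y$, and $K_P(\mathbf{x})=\sum_{\theta} x_1^{|\theta^{-1}(1)|}x_2^{|\theta^{-1}(2)|}\cdots$ summed over all $P$-partitions. The class of series-parallel posets is the smallest class of posets containing the one-element poset and closed under disjoint union $P\sqcup Q$ (relations are those of $P$ and of $Q$) and ordinal sum $P\oplus Q$ (relations are those of $P$, those of $Q$, and $x\prec y$ for all $x\in P$, $y\in Q$). *)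

(* Defs.v *)
From HB Require Import structures.
From mathcomp Require Import all_boot all_order all_algebra finmap.
From mathcomp Require Import boolp classical_sets functions cardinality fsbigop.

Set Implicit Arguments.
Unset Strict Implicit.
Unset Printing Implicit Defensive.

Import Order.TTheory GRing.Theory.

Local Open Scope order_scope.

Definition poset_iso (dP dQ : Order.disp_t)
    (P : finPOrderType dP) (Q : finPOrderType dQ) : Prop :=
  exists2 f : P -> Q, bijective f & {mono f : x y / x <= y}.

(* The two aliases of P + Q carry different orders. *)
Definition disj_union (P Q : Type) : Type := (P + Q)%type.
Definition ord_sum (P Q : Type) : Type := (P + Q)%type.

Fact disj_union_display : Order.disp_t. Proof. exact: (Order.Disp tt tt). Qed.
Fact ord_sum_display : Order.disp_t. Proof. exact: (Order.Disp tt tt). Qed.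

Section SumOrders.
Context (dP dQ : Order.disp_t) (P : finPOrderType dP) (Q : finPOrderType dQ).

Definition disj_union_le (u v : disj_union P Q) : bool :=
  match u, v with
  | inl x, inl y => x <= y
  | inr x, inr y => x <= y
  | _, _ => false
  end.

Definition ord_sum_le (u v : ord_sum P Q) : bool :=
  match u, v with
  | inl x, inl y => x <= y
  | inr x, inr y => x <= y
  | inl _, inr _ => true
  | inr _, inl _ => false
  end.

Fact disj_union_le_refl : reflexive disj_union_le.
Proof. by case=> x /=. Qed.

Fact disj_union_le_anti : antisymmetric disj_union_le.
Proof. by case=> x [] y //= /le_anti ->. Qed.

Fact disj_union_le_trans : transitive disj_union_le.
Proof. by case=> y [] x [] z //=; apply: le_trans. Qed.

Fact ord_sum_le_refl : reflexive ord_sum_le.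
Proof. by case=> x /=. Qed.

Fact ord_sum_le_anti : antisymmetric ord_sum_le.
Proof. by case=> x [] y //= /le_anti ->. Qed.

Fact ord_sum_le_trans : transitive ord_sum_le.
Proof. by case=> y [] x [] z //=; apply: le_trans. Qed.

HB.instance Definition _ := Finite.copy (disj_union P Q) (P + Q)%type.
HB.instance Definition _ := Order.Le_isPOrder.Build disj_union_display
  (disj_union P Q) disj_union_le_refl disj_union_le_anti disj_union_le_trans.

HB.instance Definition _ := Finite.copy (ord_sum P Q) (P + Q)%type.
HB.instance Definition _ := Order.Le_isPOrder.Build ord_sum_display
  (ord_sum P Q) ord_sum_le_refl ord_sum_le_anti ord_sum_le_trans.

End SumOrders.

(* Closure under isomorphism is implicit in "class of posets". *)
Inductive series_parallel :
    forall d : Order.disp_t, finPOrderType d -> Prop :=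
  | sp_point (d : Order.disp_t) (P : finPOrderType d) :
      #|P| = 1%N -> series_parallel P
  | sp_union (dP dQ : Order.disp_t)
      (P : finPOrderType dP) (Q : finPOrderType dQ) :
      series_parallel P -> series_parallel Q ->
      series_parallel (disj_union P Q : finPOrderType _)
  | sp_sum (dP dQ : Order.disp_t)
      (P : finPOrderType dP) (Q : finPOrderType dQ) :
      series_parallel P -> series_parallel Q ->
      series_parallel (ord_sum P Q : finPOrderType _)
  | sp_iso (dP dQ : Order.disp_t)
      (P : finPOrderType dP) (Q : finPOrderType dQ) :
      series_parallel P -> poset_iso P Q -> series_parallel Q.

Definition is_Ppartition (d : Order.disp_t) (P : finPOrderType d)
    (theta : {ffun P -> nat}) : Prop :=
  (forall x, (0 < theta x)%N) /\
  (forall x y, x <= y -> (theta x <= theta y)%N).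

(* m encodes x_1^(m 1) x_2^(m 2) ...; as P-partitions are positive, the index
   0 never occurs in a monomial with nonzero coefficient in K P. *)
Definition monomial := {fsfun nat -> nat with 0%N}.

(* Formal power series over the integers, as coefficient functions. *)
Definition fpseries := monomial -> int.

Definition Ppart_monomial (d : Order.disp_t) (P : finPOrderType d)
    (theta : {ffun P -> nat}) : monomial :=
  [fsfun i in [fset theta x | x in P]%fset => #|[pred x | theta x == i]| | 0%N].

(* The coefficient of m in the sum over all P-partitions theta of
   x^(Ppart_monomial theta); by K_finite this sum has finite support. *)
Definition K (d : Order.disp_t) (P : finPOrderType d) : fpseries :=
  fun m => (\sum_(theta \in [set theta | is_Ppartition theta]%classic)
              (Ppart_monomial (P := P) theta == m)%:Z)%R.

Lemma Ppart_monomialE (d : Order.disp_t) (P : finPOrderType d)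
    (theta : {ffun P -> nat}) (i : nat) :
  Ppart_monomial theta i = #|[pred x | theta x == i]|.
Proof.
rewrite fsfunE; case: ifPn => // ni; apply/esym/eq_card0 => x.
rewrite !inE; apply: contraNF ni => /eqP <-.
by apply/imfsetP; exists x.
Qed.

Lemma K_finite (d : Order.disp_t) (P : finPOrderType d) (m : monomial) :
  finite_set [set theta : {ffun P -> nat} | Ppart_monomial theta = m]%classic.
Proof.
pose g (h : {ffun P -> finsupp m}) : {ffun P -> nat} := [ffun x => val (h x)].
apply: (sub_finite_set (B := (g @` [set: {ffun P -> finsupp m}])%classic)).
  move=> theta /= thm.
  have mth x : theta x \in finsupp m.
    rewrite mem_finsupp -thm Ppart_monomialE -lt0n.
    by apply/card_gt0P; exists x; rewrite !inE.
  exists [ffun x => [` mth x]%fset] => //.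
  by apply/ffunP => x; rewrite !ffunE.
exact/finite_image/finite_finset.
Qed.

Lemma KE (d : Order.disp_t) (P : finPOrderType d) (m : monomial) :
  K P m = Posz #|` fset_set [set theta : {ffun P -> nat} |
                  is_Ppartition theta /\ Ppart_monomial theta = m]%classic|.
Proof.
set A := (X in fset_set X).
have finA : finite_set A by apply: (sub_finite_set _ (@K_finite _ P m)) => theta [].
have -> : K P m = (\sum_(theta \in A) (1%:Z))%R.
  rewrite /K [LHS]fsbig_mkcond [RHS]fsbig_mkcond; apply: eq_fsbigr => theta _.
  rewrite /patch /A; case: eqP => thm.
    congr (if _ then _ else _).
    by apply/idP/idP; rewrite !inE /=; [split|case].
  by rewrite if_same ifF //; apply/negP; rewrite inE => -[_ /thm].
by rewrite fsbig_finite //= big_const_seq count_predT iter_addr_0 natz.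
Qed.

(* Main.v *)
Require Import Defs.
From mathcomp Require Import boolp classical_sets cardinality finmap.
From mathcomp Require Import all_boot all_order all_algebra.

Set Implicit Arguments.
Unset Strict Implicit.
Unset Printing Implicit Defensive.

Import Order.TTheory GRing.Theory Num.Theory.
Local Open Scope ring_scope.

(* The series [K U] records the numbers of chains of order ideals of [U] with prescribed
   sizes of the successive differences.  Hence convolution over ideals,
   [(X * Y) U = \sum_J X J * Y (U :\: J)], takes functionals linear in [K] to functionals
   linear in [K].

   A poset is an ordinal sum with lower summand of size [m] iff it has exactly one ideal
   of size [m]; the chain counts of both summands are then read off.

   For disjoint unions, call apex of [U] an element above all minimal elements of [U].  An
   ordinal sum or a point has an apex, a disconnected poset has none.  For [0 < y < 1] the
   positive weights [y ^ #|U :\: below x| * (1 - y) ^ #|minimals U :\ x|] of the apexes [x]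
   of [U] have a sum [phi U] that is linear in [K]: in the convolution algebra, [phi] is the
   conjugate by [U |-> y ^ #|U|] of the number of maximum elements.

   Suppose [K U = K V] and let [W] be a largest component of [U] or [V], say of [U].  [K] (in
   finitely many variables) is multiplicative with values in an integral domain.
   Convolution with the restriction of [phi] to size [#|W|] acts on products of [K]'s of
   components as a derivation, with constant value [phi C] on [K C] if [#|C| = #|W|] and
   zero value otherwise.  Iterating it, one finds that the polynomials
   [\prod_C (K C + phi C * z)] over the components of [U] and of [V] (with [phi C] replaced
   by 0 for the smaller ones) coincide.  Their common root [- K W / phi W] shows that [K W]
   is proportional, hence equal, to [K W'] for a component [W'] of [V].  Cancel [K W] and
   induct. *)

Lemma prod_addr1_subset (R : comNzRingType) (I : finType) (S : {set I}) (f : I -> R) :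
  \prod_(i in S) (1 + f i) = \sum_(J : {set I} | J \subset S) \prod_(i in J) f i.
Proof.
pose F i := if i \in S then f i else 0.
transitivity (\prod_i (F i + 1)).
  rewrite big_mkcond; apply: eq_bigr => i _.
  by rewrite /F; case: (i \in S); rewrite ?add0r // addrC.
rewrite bigA_distr [RHS]big_mkcond; apply: eq_bigr => J _; rewrite -big_mkcond /=.
case: ifPn => [/subsetP sJS|/subsetPn[i iJ iS]].
  by apply: eq_bigr => i /sJS; rewrite /F => ->.
by rewrite (bigD1 i) //= /F (negPf iS) mul0r.
Qed.

Lemma deriv_prod (R : comNzRingType) (I : finType) (p : I -> {poly R}) (S : {set I}) :
  (\prod_(i in S) p i)^`() = \sum_(i in S) (p i)^`() * \prod_(j in S :\ i) p j.
Proof.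
have [n leSn] := ubnP #|S|; elim: n => // n IHn in S leSn *.
have [->|/set0Pn[i iS]] := eqVneq S set0; first by rewrite !big_set0 derivC.
rewrite (big_setD1 i) //= derivM [RHS](big_setD1 i) //= IHn; last first.
  by move: leSn; rewrite (cardsD1 i) iS.
congr (_ + _); rewrite big_distrr /=; apply: eq_bigr => j; rewrite !inE => /andP[nji jS].
rewrite mulrCA [in RHS](big_setD1 i) /= ?inE ?iS 1?eq_sym ?nji //.
by rewrite !setDDl setUC.
Qed.

Lemma linear_factor_prod (R : idomainType) (I : finType) (S : {set I})
    (a b : I -> R) (x y : R) (q : {poly R}) : y != 0 ->
  (x%:P + y *: 'X) * q = \prod_(i in S) ((a i)%:P + b i *: 'X) ->
  exists2 i, i \in S & a i * y = b i * x.
Proof.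
move=> y0 /(congr1 (map_poly (@tofrac R))).
pose z := - tofrac x / tofrac y.
have tf0 : tofrac y != 0 by rewrite tofrac_eq0.
have ev u v : (map_poly (@tofrac R) (u%:P + v *: 'X)).[z] = tofrac u + tofrac v * z.
  by rewrite rmorphD /= map_polyC map_polyZ map_polyX !hornerE.
move/(congr1 (horner^~ z)); rewrite rmorphM rmorph_prod /= hornerM horner_prod ev.
have zy : z * tofrac y = - tofrac x by rewrite /z divfK.
rewrite [tofrac y * z]mulrC zy subrr mul0r => /esym/eqP/prodf_eq0[i iS].
rewrite ev addr_eq0 => /eqP ai; exists i => //; apply/eqP.
by rewrite -tofrac_eq !tofracM ai mulNr -mulrA zy mulrN opprK.
Qed.

Lemma poly_mulrnI (R : numDomainType) n (p q : {poly R}) :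
  (0 < n)%N -> p *+ n = q *+ n -> p = q.
Proof.
move=> n_gt0 epq; apply/polyP => i; apply: (pmulrnI n_gt0).
by rewrite -!coefMn epq.
Qed.

Lemma coef_XnM_comp_Xn (R : nzRingType) (q : {poly R}) (b i m e : nat) :
  (i < b)%N -> (m < b)%N ->
  ('X^i * (q \Po 'X^b))`_(m + e * b) = (i == m)%:R * q`_e.
Proof.
move=> ltib ltmb; have b_gt0 := leq_ltn_trans (leq0n i) ltib.
rewrite coefXnM coef_comp_poly_Xn //; case: eqVneq => [->|nim].
  by rewrite ltnNge leq_addr /= addKn dvdn_mull // mulnK // mul1r.
rewrite mul0r; case: ltnP => // le_i; rewrite ifN //; apply: contra nim => dvb.
rewrite eq_sym -(modn_small ltib) -{1}(modn_small ltmb).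
by rewrite -(modnMDl e) addnC eqn_mod_dvd.
Qed.

Section Ideals.
Context (d : Order.disp_t) (T : finPOrderType d).
Implicit Types (U V J W : {set T}) (x y : T).

Definition below x : {set T} := [set y | (y <= x)%O].

Definition ideal U J := (J \subset U) && [forall x in J, U :&: below x \subset J].

Lemma idealP U J :
  reflect (J \subset U /\ forall x y, x \in J -> y \in U -> (y <= x)%O -> y \in J)
          (ideal U J).
Proof.
apply: (iffP andP) => -[sJU clJ]; split=> //.
  move=> x y xJ yU leyx; have /subsetP := forall_inP clJ x xJ.
  by apply; rewrite !inE yU.
apply/forall_inP => x xJ; apply/subsetP => y; rewrite !inE => /andP[yU].
exact: clJ.
Qed.

Lemma ideal_sub U J : ideal U J -> J \subset U.
Proof. by case/andP. Qed.

Lemma ideal_set0 U : ideal U set0.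
Proof. by apply/idealP; split; rewrite ?sub0set // => x y; rewrite inE. Qed.

Lemma ideal_refl U : ideal U U.
Proof. by apply/idealP; split. Qed.

Lemma ideal_trans U J W : ideal U J -> ideal J W -> ideal U W.
Proof.
move=> /idealP[sJU clJ] /idealP[sWJ clW]; apply/idealP; split.
  exact: subset_trans sJU.
move=> x y xW yU leyx; apply: (clW x) => //.
by apply: (clJ x) => //; apply: (subsetP sWJ).
Qed.

Lemma ideal_restrict U V J : ideal U J -> J \subset V -> V \subset U -> ideal V J.
Proof.
move=> /idealP[_ clJ] sJV /subsetP sVU; apply/idealP; split=> // x y xJ /sVU.
exact: clJ.
Qed.

Lemma ideal_below U x : ideal U (U :&: below x).
Proof.
apply/idealP; split=> [|y z]; first exact: subsetIl.
by rewrite !inE => /andP[_ leyx] zU lezy; rewrite zU (le_trans lezy).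
Qed.

Lemma ideal_below_sub U J x : ideal U J -> x \in U -> (U :&: below x \subset J) = (x \in J).
Proof.
move=> /andP[_ /forall_inP clJ] xU; apply/idP/idP => [/subsetP|/clJ //].
by apply; rewrite !inE xU lexx.
Qed.

Lemma idealU U J W : ideal U J -> ideal (U :\: J) W -> ideal U (J :|: W).
Proof.
move=> /idealP[sJU clJ] /idealP[sW clW]; apply/idealP; split=> [|x y].
  by rewrite subUset sJU (subset_trans sW) ?subsetDl.
rewrite !inE => /orP[xJ|xW] yU leyx; first by rewrite (clJ x).
by case: (boolP (y \in J)) => //= yJ; apply: (clW x); rewrite // inE yJ.
Qed.

Lemma idealD U J W : ideal U W -> ideal (U :\: J) (W :\: J).
Proof.
move=> /idealP[sWU clW]; apply/idealP; split=> [|x y]; first exact: setSD.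
by rewrite !inE => /andP[_ xW] /andP[-> yU]; apply: clW.
Qed.

Lemma cards_setD_ideal U J : ideal U J -> #|U :\: J| = (#|U| - #|J|)%N.
Proof. by move=> /ideal_sub sJU; rewrite cardsDS. Qed.

Lemma ltn_cards_setD_ideal U J : ideal U J -> J != set0 -> (#|U :\: J| < #|U|)%N.
Proof.
move=> idJ; rewrite -card_gt0 => J_gt0; rewrite cards_setD_ideal // ltn_subrL J_gt0.
exact/(leq_trans J_gt0)/subset_leq_card/ideal_sub.
Qed.

Definition minimals U := [set x in U | [forall y in U, ~~ (y < x)%O]].

Lemma minimalsP U x :
  reflect (x \in U /\ forall y, y \in U -> ~~ (y < x)%O) (x \in minimals U).
Proof. by rewrite inE; apply: (iffP andP) => -[xU /forall_inP minx]; split. Qed.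

Lemma exists_minimal_le U x : x \in U -> exists2 m, m \in minimals U & (m <= x)%O.
Proof.
move=> xU; have x_below : x \in U :&: below x by rewrite !inE xU lexx.
have [m m_below minm] := arg_minnP (fun z => #|U :&: below z|) x_below.
have /setIP[mU] : m \in U :&: below x := m_below; rewrite inE => lemx.
exists m => //; apply/minimalsP; split=> // y yU.
apply/negP => ltym; have : y \in U :&: below x by rewrite !inE yU (le_trans (ltW ltym)).
move/minm; apply/negP; rewrite -ltnNge; apply/proper_card/properP; split.
  by apply/subsetP => z; rewrite !inE => /andP[-> /le_trans->] //; apply: ltW.
by exists m; rewrite !inE mU ?lexx // (lt_geF ltym).
Qed.

Definition antichain U := [forall x in U, forall y in U, ~~ (x < y)%O].

Lemma ideal_antichain U J : ideal U J && antichain J = (J \subset minimals U).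
Proof.
apply/andP/subsetP => [[/idealP[sJU clJ] /forall_inP acJ] x xJ|sJmin].
  apply/minimalsP; split=> [|y yU]; first exact: (subsetP sJU).
  apply/negP => ltyx; have yJ := clJ x y xJ yU (ltW ltyx).
  by have /forall_inP/(_ x xJ) := acJ y yJ; rewrite ltyx.
split.
  apply/idealP; split=> [|x y xJ yU leyx].
    by apply/subsetP => x /sJmin/minimalsP[].
  have /minimalsP[_ /(_ y yU)] := sJmin x xJ.
  by rewrite lt_neqAle leyx andbT negbK => /eqP->.
apply/forall_inP => x xJ; apply/forall_inP => y yJ.
by have /minimalsP[_] := sJmin y yJ; apply; have /minimalsP[] := sJmin x xJ.
Qed.

Lemma sum_ideal_superset (R : nmodType) (G : {set T} -> R) U J : ideal U J ->
  \sum_(W | ideal U W && (J \subset W)) G W = \sum_(W | ideal (U :\: J) W) G (J :|: W).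
Proof.
move=> idJ; rewrite (reindex_onto (fun W => J :|: W) (fun W => W :\: J)) /=; last first.
  by move=> W /andP[_ sJW]; rewrite setDE setUIr setUCr setIT; apply/setUidPr.
apply: eq_bigl => W; rewrite subsetUl andbT setDUl setDv set0U; apply/andP/idP.
  by case=> idJW /eqP <-; have := idealD J idJW; rewrite setDUl setDv set0U.
move=> idW; split; first exact: idealU.
by have := ideal_sub idW; rewrite subsetD => /andP[_ /setDidPl->].
Qed.

Section Convolution.
Context (R : comNzRingType).
Implicit Types X Y Z : {set T} -> R.

Definition conv X Y U := \sum_(J | ideal U J) X J * Y (U :\: J).

Definition conv_unit U : R := (U == set0)%:R.

Lemma eq_conv X X' Y Y' U : X =1 X' -> Y =1 Y' -> conv X Y U = conv X' Y' U.
Proof. by move=> eX eY; apply: eq_bigr => J _; rewrite eX eY. Qed.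

Lemma convA X Y Z U : conv X (conv Y Z) U = conv (conv X Y) Z U.
Proof.
rewrite /conv; under [RHS]eq_bigr do rewrite big_distrl /=.
rewrite (exchange_big_dep (ideal U)) /=; last by move=> W J; apply: ideal_trans.
apply: eq_bigr => J idJ; transitivity
    (\sum_(W | ideal U W && (J \subset W)) X J * Y (W :\: J) * Z (U :\: W)); last first.
  apply: eq_bigl => W; apply: andb_id2l => idW; apply/idP/idP => [sJW|/ideal_sub //].
  exact: ideal_restrict idJ sJW (ideal_sub idW).
rewrite sum_ideal_superset // big_distrr /=; apply: eq_bigr => W /ideal_sub.
rewrite subsetD => /andP[_ /setDidPl dWJ].
by rewrite mulrA setDDl setDUl setDv set0U dWJ.
Qed.

Lemma conv_unitl Y U : conv conv_unit Y U = Y U.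
Proof.
rewrite /conv (bigD1 set0) ?ideal_set0 //= /conv_unit eqxx mul1r setD0 big1 ?addr0 //.
by move=> J /andP[_ /negPf->]; rewrite mul0r.
Qed.

Lemma convBl X X' Y U : conv (fun J => X J - X' J) Y U = conv X Y U - conv X' Y U.
Proof. by rewrite -sumrB; apply: eq_bigr => J _; rewrite mulrBl. Qed.

Lemma conv_size Y m U : conv (fun J => (#|J| == m)%:R) Y U =
  \sum_(J | ideal U J && (#|J| == m)) Y (U :\: J).
Proof.
rewrite [RHS]big_mkcondr; apply: eq_bigr => J _.
by case: eqP; rewrite ?mul1r ?mul0r.
Qed.

End Convolution.
End Ideals.

Lemma ideal_dual (d : Order.disp_t) (T : finPOrderType d) (U J : {set T}) :
  J \subset U -> @ideal _ T^d U (U :\: J) = ideal U J.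
Proof.
move=> sJU; apply/idealP/idealP => -[_ cl]; split=> //; try exact: subsetDl.
  move=> x y xJ yU leyx; apply/negPn/negP => yJ.
  by have := cl y x; rewrite !inE yJ yU xJ (subsetP sJU) //= => /(_ isT isT leyx).
move=> x y /setDP[xU xJ] yU lexy; rewrite inE yU andbT.
by apply: contra xJ => yJ; apply: (cl y).
Qed.

Lemma conv_dual (d : Order.disp_t) (T : finPOrderType d) (R : comNzRingType)
    (X Y : {set T} -> R) U : @conv _ T^d R X Y U = conv Y X U.
Proof.
rewrite /conv (reindex_onto (fun J => U :\: J) (fun J => U :\: J)) /=; last first.
  by move=> J /ideal_sub sJU; rewrite setDDr setDv set0U; apply/setIidPr.
apply: eq_big => [J|J /andP[_ /eqP->]]; last by rewrite mulrC.
have -> : (U :\: (U :\: J) == J) = (J \subset U).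
  by rewrite setDDr setDv set0U; apply/eqP/setIidPr.
have [sJU|nsJU] := boolP (J \subset U); first by rewrite andbT ideal_dual.
by rewrite andbF; apply/esym/(contraNF _ nsJU) => /ideal_sub.
Qed.

Section Mobius.
Context (R : comNzRingType).

Definition zeta (d : Order.disp_t) (T : finPOrderType d) (U : {set T}) : R := 1.

Definition mobius (d : Order.disp_t) (T : finPOrderType d) (U : {set T}) : R :=
  if antichain U then (-1) ^+ #|U| else 0.

Context (d : Order.disp_t) (T : finPOrderType d).
Implicit Types U : {set T}.

Lemma conv_mobius (X Y : {set T} -> R) U :
  conv (fun J => X J * mobius J) Y U =
  \sum_(J : {set T} | J \subset minimals U) X J * (-1) ^+ #|J| * Y (U :\: J).
Proof.
under [RHS]eq_bigl do rewrite -ideal_antichain; rewrite big_mkcondr.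
by apply: eq_bigr => J _; rewrite /mobius; case: antichain; rewrite // mulr0 mul0r.
Qed.

Lemma conv_mobius_zeta U : conv (@mobius _ T) (@zeta _ T) U = conv_unit R U.
Proof.
transitivity (conv (fun J => 1 * mobius J) (@zeta _ T) U).
  by apply: eq_conv => // J; rewrite mul1r.
rewrite conv_mobius; transitivity (\prod_(x in minimals U) (1 + -1 : R)).
  rewrite prod_addr1_subset; apply: eq_bigr => J _.
  by rewrite mul1r mulr1 prodr_const.
rewrite subrr prodr_const expr0n cards_eq0 /conv_unit; congr (nat_of_bool _)%:R.
apply/eqP/eqP => [minU0|->]; last by apply/setP => x; rewrite !inE.
apply/eqP/set0Pn => -[x xU]; have [m] := exists_minimal_le xU.
by rewrite minU0 inE.
Qed.

End Mobius.

Lemma conv_zeta_mobius (R : comNzRingType) (d : Order.disp_t) (T : finPOrderType d)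
    (U : {set T}) : conv (@zeta R _ T) (@mobius R _ T) U = conv_unit R U.
Proof.
rewrite -conv_dual -[RHS](@conv_mobius_zeta R _ T^d U).
apply: eq_bigr => J _; congr (_ * _); rewrite /mobius; congr (if _ then _ else _).
by apply/forall_inP/forall_inP => ac x xJ; apply/forall_inP => y yJ;
   have /forall_inP/(_ x xJ) := ac y yJ.
Qed.

Section ChainCounts.
Context (d : Order.disp_t) (T : finPOrderType d).
Implicit Types (U V J W : {set T}) (a : seq nat).

(* The number of chains [set0 = J_0 <= J_1 <= ... <= J_k = U] of ideals of [U] whose
   successive differences have the sizes listed in [a]. *)
Fixpoint nchains a : {set T} -> int :=
  if a is m :: a' then conv (fun J => (#|J| == m)%:R) (nchains a') else conv_unit int.

#[global] Arguments nchains : simpl never.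

Lemma nchains_nil U : nchains [::] U = (U == set0)%:R.
Proof. by []. Qed.

Lemma nchains_cons m a U :
  nchains (m :: a) U = \sum_(J | ideal U J && (#|J| == m)) nchains a (U :\: J).
Proof. exact: conv_size. Qed.

Lemma nchains_cat a b U : nchains (a ++ b) U = conv (nchains a) (nchains b) U.
Proof.
elim: a U => [|m a IHa] U; first by rewrite conv_unitl.
by rewrite -convA; apply: eq_conv.
Qed.

Lemma nchains_seq1 m U : nchains [:: m] U = (#|U| == m)%:R.
Proof.
rewrite nchains_cons big_mkcondr (bigD1 U) ?ideal_refl //=.
rewrite nchains_nil setDv eqxx big1 => [|J /andP[idJ nJU]].
  by rewrite addr0; case: (_ == m).
rewrite nchains_nil setD_eq0 [U \subset J]negbTE ?if_same //.
by apply: contra nJU => sUJ; rewrite eqEsubset sUJ ideal_sub.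
Qed.

Lemma nchains_rcons a m U :
  nchains (rcons a m) U = \sum_(J | ideal U J && (#|U :\: J| == m)) nchains a J.
Proof.
rewrite -cats1 nchains_cat [RHS]big_mkcondr; apply: eq_bigr => J _.
by rewrite nchains_seq1; case: eqP; rewrite ?mulr1 ?mulr0.
Qed.

Lemma nchains_eq0 a U : #|U| != sumn a -> nchains a U = 0.
Proof.
elim: a U => [|m a IHa] U /=; first by rewrite cards_eq0 nchains_nil => /negPf->.
move=> nU; rewrite nchains_cons big1 // => J /andP[idJ /eqP cJ].
rewrite IHa // cards_setD_ideal // cJ; apply: contra nU => /eqP <-.
by rewrite subnKC // -cJ subset_leq_card // ideal_sub.
Qed.

Lemma nchains_cons0 a U : nchains (0%N :: a) U = nchains a U.
Proof. by rewrite -[RHS]conv_unitl; apply: eq_conv => // J; rewrite cards_eq0. Qed.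

Lemma nchains_filter_neq0 a U : nchains [seq m <- a | m != 0%N] U = nchains a U.
Proof.
elim: a U => [|m a IHa] U //=; case: eqP => [->|_] /=; first by rewrite IHa nchains_cons0.
exact: eq_conv.
Qed.

Lemma nchains_cat_nseq0 a k U : nchains (a ++ nseq k 0%N) U = nchains a U.
Proof.
rewrite -nchains_filter_neq0 -[RHS]nchains_filter_neq0 filter_cat; congr (nchains _ U).
by elim: k => [|k IHk] //=; rewrite cats0.
Qed.

Definition Kequiv U V := forall a, nchains a U = nchains a V.

Lemma Kequiv_sym U V : Kequiv U V -> Kequiv V U.
Proof. by move=> eUV a. Qed.

Lemma Kequiv_card U V : Kequiv U V -> #|U| = #|V|.
Proof. by move/(_ [:: #|U|]); rewrite !nchains_seq1 eqxx; case: eqP. Qed.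

Lemma Kequiv_eq0 U V : Kequiv U V -> (U == set0) = (V == set0).
Proof. by move=> /Kequiv_card cUV; rewrite -!cards_eq0 cUV. Qed.

(* Zero entries can be inserted and removed, and the others are at most [#|T|]. *)
Lemma Kequiv_of_size k U V : (#|T| <= k)%N ->
  (forall a, size a = k -> all (leq^~ #|T|) a -> nchains a U = nchains a V) -> Kequiv U V.
Proof.
move=> leTk eqN a; have [leaT|ltTa] := leqP (sumn a) #|T|; last first.
  by rewrite !nchains_eq0 // neq_ltn (leq_ltn_trans (max_card _)).
rewrite -[LHS]nchains_filter_neq0 -[RHS]nchains_filter_neq0; set b := filter _ _.
have [leb all_b] : (size b <= sumn a)%N /\ all (leq^~ (sumn a)) b.
  rewrite {leaT}/b; elim: a => //= m a [leb all_b].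
  have {}all_b : all (leq^~ (m + sumn a)%N) [seq i <- a | i != 0%N].
    by apply: sub_all all_b => i /leq_trans-> //; apply: leq_addl.
  by case: m all_b => [|m] /= -> //; rewrite leq_addr ltnS (leq_trans leb) ?leq_addl.
have lebk := leq_trans leb (leq_trans leaT leTk).
rewrite -(nchains_cat_nseq0 b (k - size b)) -[RHS](nchains_cat_nseq0 b (k - size b)).
apply: eqN; first by rewrite size_cat size_nseq subnKC.
rewrite all_cat all_nseq orbT andbT.
by apply: sub_all all_b => i /leq_trans->.
Qed.

Section LinearFunctionals.
Context (R : comNzRingType).
Implicit Types X Y : {set T} -> R.

(* The quantities that are linear in [K]. *)
Definition Klinear X :=
  exists s : seq (R * seq nat), forall U, X U = \sum_(p <- s) p.1 * (nchains p.2 U)%:~R.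

Lemma Klinear_Kequiv X U V : Klinear X -> Kequiv U V -> X U = X V.
Proof. by case=> s sX eUV; rewrite !sX; apply: eq_bigr => p _; rewrite eUV. Qed.

Lemma eq_Klinear X Y : X =1 Y -> Klinear X -> Klinear Y.
Proof. by move=> eXY [s sX]; exists s => U; rewrite -eXY. Qed.

Lemma KlinearB X Y : Klinear X -> Klinear Y -> Klinear (fun U => X U - Y U).
Proof.
case=> s sX [t tY]; exists (s ++ [seq (- p.1, p.2) | p <- t]) => U.
rewrite big_cat big_map sX tY /= -sumrN; congr (_ + _).
by apply: eq_bigr => p _; rewrite mulNr.
Qed.

Lemma Klinear_conv X Y : Klinear X -> Klinear Y -> Klinear (conv X Y).
Proof.
case=> s sX [t tY]; exists [seq (p.1 * q.1, p.2 ++ q.2) | p <- s, q <- t] => U.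
rewrite big_allpairs_dep /= /conv.
under [LHS]eq_bigr do rewrite sX big_distrl /=.
rewrite exchange_big /=; apply: eq_bigr => p _.
under [LHS]eq_bigr do rewrite tY big_distrr /=.
rewrite exchange_big /=; apply: eq_bigr => q _.
rewrite nchains_cat rmorph_sum /= big_distrr /=; apply: eq_bigr => J _.
by rewrite rmorphM /= mulrACA.
Qed.

Lemma Klinear_card (g : nat -> R) : Klinear (fun U => g #|U|).
Proof.
exists [seq (g m, [:: m]) | m <- iota 0 #|T|.+1] => U.
have Ui : #|U| \in iota 0 #|T|.+1 by rewrite mem_iota ltnS max_card.
rewrite big_map (bigD1_seq _ Ui (iota_uniq _ _)) /= nchains_seq1 eqxx mulr1.
by rewrite big1 ?addr0 // => m nm; rewrite nchains_seq1 eq_sym (negPf nm) mulr0.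
Qed.

Lemma Klinear_cardM (g : nat -> R) X : Klinear X -> Klinear (fun U => g #|U| * X U).
Proof.
case=> s sX; exists [seq (g (sumn p.2) * p.1, p.2) | p <- s] => U.
rewrite sX big_map big_distrr; apply: eq_bigr => p _ /=; rewrite mulrA.
by have [->//|nU] := eqVneq #|U| (sumn p.2); rewrite nchains_eq0 // !mulr0.
Qed.

(* The recursion [Y U = conv_unit U - \sum_(J != set0) X J * Y (U :\: J)] is iterated,
   [#|T|.+1] times being enough. *)
Lemma Klinear_conv_inv X Y : Klinear X -> X set0 = 1 ->
  (forall U, conv X Y U = conv_unit R U) -> Klinear Y.
Proof.
move=> KX X0 XY; have Kunit : Klinear (@conv_unit _ T R).
  by apply: eq_Klinear (Klinear_card (fun m => (m == 0%N)%:R)) => U; rewrite cards_eq0.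
suff [Z KZ eZ] : exists2 Z, Klinear Z & forall U, (#|U| < #|T|.+1)%N -> Z U = Y U.
  by apply: eq_Klinear KZ => U; rewrite eZ // ltnS max_card.
elim: #|T|.+1 => [|m [Z KZ eZ]].
  by exists (fun=> 0) => //; apply: (Klinear_card (fun=> 0)).
exists (fun U => conv_unit R U - conv (fun J => X J - conv_unit R J) Z U).
  by apply/KlinearB/Klinear_conv/KZ/KlinearB.
move=> U leUm; transitivity (conv_unit R U - conv (fun J => X J - conv_unit R J) Y U).
  congr (_ - _); apply: eq_bigr => J idJ; have [->|nJ] := eqVneq J set0.
    by rewrite X0 /conv_unit eqxx subrr !mul0r.
  by rewrite eZ // (leq_trans (ltn_cards_setD_ideal idJ nJ)).
by rewrite convBl XY conv_unitl opprB addrCA subrr addr0.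
Qed.

Lemma Klinear_zeta : Klinear (@zeta R _ T).
Proof. exact: (Klinear_card (fun=> 1)). Qed.

Lemma Klinear_mobius : Klinear (@mobius R _ T).
Proof. by apply: Klinear_conv_inv Klinear_zeta _ (@conv_zeta_mobius R _ T). Qed.

End LinearFunctionals.

Lemma Klinear_rmorph (R S : comNzRingType) (f : {rmorphism R -> S}) (X : {set T} -> R) :
  Klinear X -> Klinear (fun U => f (X U)).
Proof.
case=> s sX; exists [seq (f p.1, p.2) | p <- s] => U.
rewrite sX big_map rmorph_sum; apply: eq_bigr => p _.
by rewrite rmorphM rmorph_int.
Qed.

End ChainCounts.

Section Apexes.
Context (d : Order.disp_t) (T : finPOrderType d).
Implicit Types (U A B J W : {set T}) (x y : T).

Definition apexes U := [set x in U | minimals U \subset below x].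

Definition indep A B := {in A & B, forall x y, (x >< y)%O}.

Definition ordsum A B := {in A & B, forall x y, (x < y)%O}.

Lemma indep_sym A B : indep A B -> indep B A.
Proof. by move=> AB x y xB yA; rewrite comparable_sym AB. Qed.

Lemma indep_sub A B A' B' : A' \subset A -> B' \subset B -> indep A B -> indep A' B'.
Proof. by move=> /subsetP sA /subsetP sB; apply: sub_in11. Qed.

Lemma indep_disjoint A B : indep A B -> [disjoint A & B].
Proof.
move=> AB; apply/pred0P => x; apply: contraTF isT => /andP[xA xB].
by have := AB x x xA xB; rewrite comparablexx.
Qed.

Lemma indep_leF A B x y : indep A B -> x \in A -> y \in B ->
  ((x <= y)%O = false) * ((y <= x)%O = false).
Proof.
move=> AB xA yB; have := AB x y xA yB.
by rewrite /Order.comparable negb_or => /andP[/negPf-> /negPf->].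
Qed.

Lemma apexes_indep A B : indep A B -> A != set0 -> B != set0 -> apexes (A :|: B) = set0.
Proof.
move=> AB nA nB; apply/setP => x; rewrite in_set0.
wlog xA : A B AB nA nB / x \in A => [wlogA|].
  have [xA|xA] := boolP (x \in A); first exact: wlogA.
  have [xB|xB] := boolP (x \in B); first by rewrite setUC wlogA //; apply: indep_sym.
  by rewrite !inE (negPf xA) (negPf xB).
have [b bB] := set0Pn _ nB; have bU : b \in A :|: B by rewrite inE bB orbT.
have [m minm lemb] := exists_minimal_le bU.
have mB : m \in B.
  by have /minimalsP[/setUP[mA|//] _] := minm; rewrite (indep_leF AB mA bB) in lemb.
rewrite inE; apply/negP => /andP[_ /subsetP/(_ m minm)].
by rewrite inE (indep_leF AB xA mB).
Qed.

Lemma sub_apexes_ordsum A B : A != set0 -> ordsum A B -> B \subset apexes (A :|: B).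
Proof.
move=> /set0Pn[a aA] AB; apply/subsetP => b bB; rewrite !inE bB orbT /=.
apply/subsetP => m /minimalsP[/setUP[mA|mB] minm]; first by rewrite inE ltW // AB.
by have := minm a; rewrite inE aA AB // => /(_ isT).
Qed.

Lemma apexes_set1 x : apexes [set x] = [set x].
Proof.
apply/setP => z; rewrite !inE; case: eqP => //= ->.
by apply/subsetP => m; rewrite !inE => /andP[/eqP->].
Qed.

Section ApexSum.
Context (R : comNzRingType) (y : R).

Definition apex_sum U : R :=
  \sum_(x in apexes U) y ^+ #|U :\: below x| * (1 - y) ^+ #|minimals U :\ x|.

Lemma conv_card (Y : {set T} -> R) U : conv (fun J => #|J|%:R) Y U =
  \sum_(x in U) conv (@zeta R _ T) Y (U :\: below x).
Proof.
rewrite /conv; transitivity (\sum_(J | ideal U J) \sum_(x in U | x \in J) Y (U :\: J)).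
  apply: eq_bigr => J /ideal_sub sJU; rewrite sumr_const mulr_natl; congr (_ *+ _).
  by apply: eq_card => x; rewrite [RHS]unfold_in andb_idl //; apply: (subsetP sJU).
rewrite (exchange_big_dep (mem U)) /=; last by move=> J x _ /andP[].
apply: eq_bigr => x xU; rewrite xU /=.
under eq_bigl => J do rewrite (andb_id2l (fun idJ => esym (ideal_below_sub idJ xU))).
rewrite sum_ideal_superset ?ideal_below // setDIr setDv set0U.
by apply: eq_bigr => W _; rewrite mul1r -setDDl setDIr setDv set0U.
Qed.

Lemma Klinear_sum_setD_below : Klinear (fun U => \sum_(x in U) y ^+ #|U :\: below x|).
Proof.
have Kmu := Klinear_conv (Klinear_mobius T R) (Klinear_card T (fun n => y ^+ n)).
apply: eq_Klinear (Klinear_conv (Klinear_card T (fun n => n%:R)) Kmu) => U.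
rewrite conv_card; apply: eq_bigr => x _.
transitivity (conv (@conv_unit _ T R) (fun W => y ^+ #|W|) (U :\: below x)).
  by rewrite convA; apply: eq_conv => // J; rewrite conv_zeta_mobius.
exact: conv_unitl.
Qed.

Lemma prod_subX_apex U x : x \in U ->
  y ^+ #|U :\: below x| * \prod_(m in minimals U :\ x) (1 - y ^+ (m \in below x)) =
  if x \in apexes U then y ^+ #|U :\: below x| * (1 - y) ^+ #|minimals U :\ x| else 0.
Proof.
move=> xU; rewrite inE xU /=; case: ifPn => [/subsetP minx|/subsetPn[m minm nx]].
  congr (_ * _); rewrite -prodr_const; apply: eq_bigr => m /setD1P[_ /minx ->].
  by rewrite expr1.
rewrite (bigD1 m) /=; first by rewrite (negPf nx) expr0 subrr mul0r mulr0.
by rewrite in_setD1 minm andbT; apply: contraNneq nx => ->; rewrite inE lexx.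
Qed.

Lemma conv_mobius_apex_sum U :
  conv (fun J => y ^+ #|J| * mobius R J) (fun W => \sum_(x in W) y ^+ #|W :\: below x|) U =
  apex_sum U.
Proof.
rewrite conv_mobius /apex_sum; under eq_bigr do rewrite big_distrr /=.
rewrite (exchange_big_dep (mem U)) /=; last by move=> J x _ /setDP[].
rewrite [RHS]big_mkcond [LHS]big_mkcond; apply: eq_bigr => x _.
case: ifPn => [xU|xU]; last by rewrite inE (negPf xU).
rewrite -prod_subX_apex // prod_addr1_subset big_distrr /=.
apply: eq_big => [J|J /andP[/subsetP sJmin /setDP[_ xJ]]].
  by rewrite subsetD1 inE xU andbT.
have sJU : J \subset U by apply/subsetP => m /sJmin/minimalsP[].
have -> : \prod_(m in J) - y ^+ (m \in below x) = (-1) ^+ #|J| * y ^+ #|J :&: below x|.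
  rewrite prodrN; congr (_ * _); rewrite -prodr_const [RHS]big_mkcond [LHS]big_mkcond.
  by apply: eq_bigr => m _; rewrite in_setI; case: (m \in J); case: (m \in below x).
rewrite mulrCA [_ * (-1) ^+ _]mulrC -mulrA -!exprD; congr (_ * y ^+ _).
have cJ := cardsID (below x) J; have cUJ := cardsID J (U :\: below x).
rewrite setIDAC (setIidPr sJU) in cUJ.
by rewrite -cUJ -cJ !setDDl [J :|: _]setUC -addnA addnC.
Qed.

Lemma Klinear_apex_sum : Klinear apex_sum.
Proof.
apply: (eq_Klinear conv_mobius_apex_sum).
exact: Klinear_conv (Klinear_cardM _ (Klinear_mobius T R)) Klinear_sum_setD_below.
Qed.

Lemma apex_sum_indep A B :
  indep A B -> A != set0 -> B != set0 -> apex_sum (A :|: B) = 0.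
Proof. by move=> AB nA nB; rewrite /apex_sum apexes_indep ?big_set0. Qed.

Lemma apex_sum_set0 : apex_sum set0 = 0.
Proof. by rewrite /apex_sum big1 // => x; rewrite !inE. Qed.

End ApexSum.

Lemma apex_sum_gt0 (R : numDomainType) (y : R) U :
  0 < y < 1 -> apexes U != set0 -> 0 < apex_sum y U.
Proof.
case/andP=> y_gt0 y_lt1 /set0Pn[x xU]; rewrite /apex_sum (big_setD1 x) //=.
rewrite ltr_wpDr ?mulr_gt0 ?exprn_gt0 ?subr_gt0 // sumr_ge0 // => z _.
by rewrite mulr_ge0 ?exprn_ge0 ?subr_ge0 // ltW.
Qed.

End Apexes.

Section Components.
Context (d : Order.disp_t) (T : finPOrderType d).
Implicit Types (A B J W : {set T}) (S : {set {set T}}).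

Lemma setDU_indep A B J W : indep A B -> J \subset A -> W \subset B ->
  (A :|: B) :\: (J :|: W) = (A :\: J) :|: (B :\: W).
Proof.
move=> /indep_disjoint dAB sJA sWB; rewrite setDUl -!setDDl; congr (_ :|: _).
  by apply/setDidPl; apply: disjointWl (subsetDl _ _) (disjointWr sWB dAB).
rewrite setDDl setUC -setDDl; apply/setDidPl; rewrite disjoint_sym.
exact: disjointWl sJA (disjointWr (subsetDl _ _) dAB).
Qed.

Lemma cardsU_indep A B : indep A B -> #|A :|: B| = (#|A| + #|B|)%N.
Proof. by move/indep_disjoint; rewrite -leq_card_setU => /eqP. Qed.

Lemma ideal_setU_indep A B J W : indep A B -> J \subset A -> W \subset B ->
  ideal (A :|: B) (J :|: W) = ideal A J && ideal B W.
Proof.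
move=> AB sJA sWB; have [sA sB] := (subsetP sJA, subsetP sWB).
apply/idealP/andP => [[_ cl]|[/idealP[_ clJ] /idealP[_ clW]]].
  split; apply/idealP; split=> // x y xin yin leyx.
    have := cl x y; rewrite !inE xin yin => /(_ isT isT leyx) /orP[//|/sB yB].
    by have := indep_leF AB yin yB; rewrite lexx => -[].
  have := cl x y; rewrite !inE xin yin !orbT => /(_ isT isT leyx) /orP[/sA yA|//].
  by have := indep_leF AB yA yin; rewrite lexx => -[].
split=> [|x y]; first exact: setUSS.
rewrite !inE => /orP[xJ|xW] /orP[yA|yB] leyx.
- by rewrite (clJ x).
- by rewrite (indep_leF AB (sA x xJ) yB) in leyx.
- by rewrite (indep_leF AB yA (sB x xW)) in leyx.
- by rewrite (clW x) ?orbT.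
Qed.

Lemma sum_ideal_indep (R : nmodType) (G : {set T} -> R) A B : indep A B ->
  \sum_(J | ideal (A :|: B) J) G J =
  \sum_(J | ideal A J) \sum_(W | ideal B W) G (J :|: W).
Proof.
move=> AB; rewrite pair_big /=.
rewrite (reindex_onto (fun p : {set T} * {set T} => p.1 :|: p.2)
                      (fun J => (J :&: A, J :&: B))) /=; last first.
  by move=> J /ideal_sub sJ; rewrite -setIUr; apply/setIidPl.
apply: eq_bigl => -[J W] /=; apply/andP/andP => [[idJW /eqP[eJ eW]]|[idJ idW]].
  have [sJA sWB] : J \subset A /\ W \subset B by split; [rewrite -eJ|rewrite -eW]; apply: subsetIr.
  by apply/andP; rewrite -ideal_setU_indep.
have [sJA sWB] := (ideal_sub idJ, ideal_sub idW).
rewrite ideal_setU_indep // idJ idW !setIUl (setIidPl sJA) (setIidPl sWB).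
have /disjoint_setI0 -> : [disjoint W & A].
  exact/indep_disjoint/indep_sym/(indep_sub (subxx A) sWB AB).
have /disjoint_setI0 -> : [disjoint J & B] by exact/indep_disjoint/(indep_sub sJA (subxx B) AB).
by rewrite setU0 set0U.
Qed.

Section Multiplicative.
Context (R : comNzRingType).
Implicit Types X Y : {set T} -> R.

Definition indep_multiplicative X :=
  X set0 = 1 /\ forall A B, indep A B -> X (A :|: B) = X A * X B.

Lemma conv_indep_multiplicative X Y :
  indep_multiplicative X -> indep_multiplicative Y -> indep_multiplicative (conv X Y).
Proof.
move=> [X0 XM] [Y0 YM]; split=> [|A B AB].
  rewrite /conv (big_pred1 set0) ?setD0 ?X0 ?Y0 ?mulr1 // => J.
  by apply/idP/eqP => [/ideal_sub|->]; rewrite ?subset0 ?ideal_set0 // => /eqP.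
rewrite /conv sum_ideal_indep // big_distrl; apply: eq_bigr => J /ideal_sub sJA /=.
rewrite big_distrr; apply: eq_bigr => W /ideal_sub sWB /=.
rewrite setDU_indep // (XM _ _ (indep_sub sJA sWB AB)) mulrACA.
by rewrite (YM _ _ (indep_sub (subsetDl A J) (subsetDl B W) AB)).
Qed.

Definition pairwise_indep S := {in S &, forall A B, A != B -> indep A B}.

Lemma pairwise_indep_sub S S' : S' \subset S -> pairwise_indep S -> pairwise_indep S'.
Proof. by move=> /subsetP sS'; apply: sub_in2. Qed.

Lemma cover_setD1 S W : W \in S -> cover S = W :|: cover (S :\ W).
Proof. exact: big_setD1. Qed.

Lemma indep_cover S W : pairwise_indep S -> W \in S -> indep W (cover (S :\ W)).
Proof.
move=> iS WS x y xW /bigcupP[W' /setD1P[nW' W'S] yW'].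
by apply: (iS W W') => //; rewrite eq_sym.
Qed.

Lemma cover_setD S W : pairwise_indep S -> W \in S -> cover S :\: W = cover (S :\ W).
Proof.
move=> iS WS; rewrite (cover_setD1 WS) setDUl setDv set0U.
by apply/setDidPl; rewrite disjoint_sym; apply/indep_disjoint/indep_cover.
Qed.

Lemma indep_multiplicative_cover X S :
  indep_multiplicative X -> pairwise_indep S -> X (cover S) = \prod_(W in S) X W.
Proof.
move=> [X0 XM]; have [n leSn] := ubnP #|S|; elim: n => // n IHn in S leSn * => iS.
have [->|/set0Pn[W WS]] := eqVneq S set0; first by rewrite /cover !big_set0.
rewrite (cover_setD1 WS) XM; last exact: indep_cover.
rewrite (big_setD1 W) //= IHn //; first by move: leSn; rewrite (cardsD1 W) WS.
exact: pairwise_indep_sub (subD1set _ _) iS.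
Qed.

Definition infinitesimal X :=
  X set0 = 0 /\
  forall A B, indep A B -> A != set0 -> B != set0 -> X (A :|: B) = 0.

Lemma ideal_cover S W : pairwise_indep S -> W \in S -> ideal (cover S) W.
Proof.
move=> iS WS; apply/idealP; split=> [|x y xW]; first exact: bigcup_sup.
rewrite (cover_setD1 WS) inE => /orP[//|yS].
by rewrite (indep_leF (indep_cover iS WS) xW yS).
Qed.

Lemma infinitesimal_sub_cover X S J : infinitesimal X -> pairwise_indep S ->
  J \subset cover S -> (forall W, W \in S -> ~~ (J \subset W)) -> X J = 0.
Proof.
move=> [X0 Xindep] iS /subsetP sJ nJ.
have [->//|/set0Pn[j jJ]] := eqVneq J set0; have /bigcupP[W WS jW] := sJ j jJ.
rewrite -(setID J W); apply: Xindep; last by rewrite setD_eq0 nJ.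
  move=> x y /setIP[_ xW] /setDP[yJ yW]; apply: (indep_cover iS WS) => //.
  by have := sJ y yJ; rewrite (cover_setD1 WS) inE (negPf yW).
by apply/set0Pn; exists j; rewrite inE jJ.
Qed.

Lemma conv_infinitesimal_cover X Y S : infinitesimal X -> pairwise_indep S ->
  (forall W J, W \in S -> J \proper W -> X J = 0) ->
  conv X Y (cover S) = \sum_(W in S) X W * Y (cover (S :\ W)).
Proof.
move=> infX iS properX; rewrite /conv [LHS]big_mkcond [RHS]big_mkcond /=.
apply: eq_bigr => J _; case: (boolP (J \in S)) => JS.
  by rewrite ideal_cover // cover_setD.
case: ifP => // /ideal_sub sJ; suff -> : X J = 0 by rewrite mul0r.
have [/exists_inP[W WS sJW]|nJ] := boolP [exists W in S, J \subset W].
  apply: (properX W) => //; rewrite properEneq sJW andbT.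
  by apply: contraNneq JS => ->.
apply: infinitesimal_sub_cover sJ _ => // W WS.
by apply: contra nJ => sJW; apply/exists_inP; exists W.
Qed.

Definition split_poly X Y S : {poly R} :=
  \prod_(W in S) ((X W)%:P + Y W *: 'X).

(* [conv Y] acts on the products of values of [X] as the derivation [X W |-> Y W]. *)
Lemma iter_conv_cover X Y S j :
  indep_multiplicative X -> infinitesimal Y -> pairwise_indep S ->
  (forall W J, W \in S -> J \proper W -> Y J = 0) ->
  iter j (conv Y) X (cover S) = (split_poly X Y S)`_j *+ j`!.
Proof.
move=> multX infY; elim: j S => [|j IHj] S iS properY.
  rewrite /split_poly -horner_coef0 horner_prod indep_multiplicative_cover //.
  by apply: eq_bigr => W _; rewrite !hornerE.
rewrite iterS conv_infinitesimal_cover // factS mulrnA -coef_deriv deriv_prod.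
rewrite coef_sum -sumrMnl; apply: eq_bigr => W WS.
rewrite derivD derivC add0r derivZ derivX -mul_polyC mulr1 coefCM -mulrnAr IHj //.
  exact: pairwise_indep_sub (subD1set _ _) iS.
by move=> W' J /setD1P[_]; apply: properY.
Qed.

End Multiplicative.
End Components.

Section ChainPolynomials.
Context (d : Order.disp_t) (T : finPOrderType d) (R : numDomainType).
Implicit Types (U V : {set T}) (a : seq nat).

(* [K] in [k] variables, the i-th one being specialized to ['X^(#|T|.+1 ^ i)]; the
   exponents stay below the base [#|T|.+1], so that no coefficients get merged. *)
Fixpoint chain_poly k : {set T} -> {poly R} :=
  if k is k'.+1 then
    conv (fun J => 'X^#|J|) (fun W => chain_poly k' W \Po 'X^(#|T|.+1))
  else @conv_unit _ T {poly R}.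

Definition chain_exponent a := foldr (fun m e => m + e * #|T|.+1)%N 0%N a.

Lemma coef_chain_poly a U : all (leq^~ #|T|) a ->
  (chain_poly (size a) U)`_(chain_exponent a) = (nchains a U)%:~R.
Proof.
elim: a U => [|m a IHa] U /=.
  by rewrite nchains_nil /conv_unit; case: (U == set0); rewrite ?coef1 ?coef0.
case/andP=> lem /IHa {}IHa; rewrite nchains_cons rmorph_sum /= coef_sum [RHS]big_mkcondr.
apply: eq_bigr => J _; rewrite coef_XnM_comp_Xn ?ltnS ?max_card //.
by rewrite IHa; case: eqP; rewrite ?mul1r ?mul0r.
Qed.

Lemma Klinear_chain_poly k : Klinear (chain_poly k).
Proof.
elim: k => [|k IHk].
  by apply: eq_Klinear (Klinear_card T (fun m => (m == 0%N)%:R)) => U; rewrite cards_eq0.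
exact: Klinear_conv (Klinear_card T (fun m => 'X^m)) (Klinear_rmorph (comp_poly _) IHk).
Qed.

Lemma indep_multiplicative_chain_poly k : indep_multiplicative (chain_poly k).
Proof.
elim: k => [|k [IH0 IHM]].
  rewrite /= /conv_unit; split=> [|A B _]; first by rewrite eqxx.
  by rewrite setU_eq0; case: (A == set0); rewrite ?mul1r ?mul0r.
apply: (conv_indep_multiplicative (Y := fun W => chain_poly k W \Po _)).
  by split=> [|A B AB]; [rewrite cards0 | rewrite cardsU_indep // exprD].
by split=> [|A B AB]; [rewrite IH0 comp_polyC | rewrite IHM // comp_polyM].
Qed.

Lemma chain_poly_proportional k U V (b c : R) : (#|T| < k)%N -> b != 0 ->
  b *: chain_poly k U = c *: chain_poly k V -> Kequiv U V /\ b = c.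
Proof.
case: k => // k ltTk b0 eUV.
have eN a : size a = k.+1 -> all (leq^~ #|T|) a ->
    b * (nchains a U)%:~R = c * (nchains a V)%:~R.
  by move=> sa all_a; rewrite -!coef_chain_poly // sa -!coefZ eUV.
have : b * (nchains [:: #|U|] U)%:~R = c * (nchains [:: #|U|] V)%:~R.
  rewrite -(nchains_cat_nseq0 [:: #|U|] k) -(nchains_cat_nseq0 [:: #|U|] k V).
  by apply: eN; rewrite /= ?size_nseq // max_card all_nseq orbT.
rewrite !nchains_seq1 eqxx mulr1; case: eqP => _; rewrite ?mulr1 ?mulr0 => ebc.
  split=> //; apply: (Kequiv_of_size (ltnW ltTk)) => a sa all_a.
  by apply: (@intr_inj R); apply: (mulfI b0); rewrite eN // ebc.
by rewrite ebc eqxx in b0.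
Qed.

Lemma chain_poly_neq0 k U : (#|T| < k)%N -> chain_poly k U != 0.
Proof.
move=> ltTk; apply/eqP => kU0.
have [|_ /eqP] := chain_poly_proportional (b := 1) (c := 0) (U := U) (V := U) ltTk (oner_neq0 R).
  by rewrite kU0 !scaler0.
by rewrite oner_eq0.
Qed.

End ChainPolynomials.

Section MatchingComponents.
Context (d : Order.disp_t) (T : finPOrderType d).
Implicit Types (U V W X : {set T}) (S : {set {set T}}).

Definition apex_decomposition S :=
  pairwise_indep S /\ {in S, forall W, apexes W != set0}.

Lemma Kequiv_apexes_eq0 U V : Kequiv U V -> (apexes U == set0) = (apexes V == set0).
Proof.
move=> eUV; have apex_sumE W : (apexes W == set0) = (apex_sum (2^-1 : rat) W == 0).
  have [a0|aW] := eqVneq (apexes W) set0; first by rewrite /apex_sum a0 big_set0 eqxx.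
  by rewrite gt_eqF // apex_sum_gt0.
by rewrite !apex_sumE (Klinear_Kequiv (Klinear_apex_sum _ _) eUV).
Qed.

(* Any value in (0, 1) would do for 1/2. *)
Definition apex_sum_size n U : rat := (#|U| == n)%:R * apex_sum (2^-1) U.

Lemma infinitesimal_apex_sum_size n : infinitesimal (fun U => (apex_sum_size n U)%:P).
Proof.
split=> [|A B AB nA nB]; first by rewrite /apex_sum_size apex_sum_set0 mulr0.
by rewrite /apex_sum_size apex_sum_indep ?mulr0.
Qed.

Lemma Klinear_apex_sum_size n : Klinear (fun U => (apex_sum_size n U)%:P).
Proof.
apply: (Klinear_rmorph polyC).
exact: (Klinear_cardM (fun m => (m == n)%:R) (Klinear_apex_sum _ _)).
Qed.

Lemma apex_sum_size_proper n U V :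
  (#|V| <= n)%N -> U \proper V -> apex_sum_size n U = 0.
Proof.
by move=> leVn /proper_card ltUV; rewrite /apex_sum_size ltn_eqF ?mul0r // (leq_trans ltUV).
Qed.

Lemma split_poly_Kequiv S S' n k : pairwise_indep S -> pairwise_indep S' ->
  {in S, forall W, #|W| <= n}%N -> {in S', forall W, #|W| <= n}%N ->
  Kequiv (cover S) (cover S') ->
  split_poly (@chain_poly _ T _ k) (fun W => (apex_sum_size n W)%:P) S =
  split_poly (@chain_poly _ T _ k) (fun W => (apex_sum_size n W)%:P) S'.
Proof.
move=> iS iS' leSn leS'n eSS'; apply/polyP => j; apply: (poly_mulrnI (fact_gt0 j)).
have multK := indep_multiplicative_chain_poly T rat k.
have infA := infinitesimal_apex_sum_size n.
rewrite -!iter_conv_cover //; last 2 first.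
- by move=> W J /leS'n leWn /(apex_sum_size_proper leWn)->.
- by move=> W J /leSn leWn /(apex_sum_size_proper leWn)->.
apply: Klinear_Kequiv eSS'; elim: j => [|j IHj]; first exact: Klinear_chain_poly.
exact: Klinear_conv (Klinear_apex_sum_size n) IHj.
Qed.

Lemma exists_Kequiv_component S S' W : apex_decomposition S -> pairwise_indep S' ->
  {in S, forall X, #|X| <= #|W|}%N -> {in S', forall X, #|X| <= #|W|}%N -> W \in S ->
  Kequiv (cover S) (cover S') ->
  exists2 W', W' \in S' &
    Kequiv W W' /\ Kequiv (cover S :\: W) (cover S' :\: W').
Proof.
move=> [iS apexS] iS' leS leS' WS eSS'; pose k := #|T|.+1.
have [_ multK] := indep_multiplicative_chain_poly T rat k.
have ltTk : (#|T| < k)%N by [].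
have aW_neq0 : apex_sum_size #|W| W != 0.
  by rewrite /apex_sum_size eqxx mul1r gt_eqF // apex_sum_gt0 ?apexS.
have := split_poly_Kequiv k iS iS' leS leS' eSS'.
rewrite {1}/split_poly (big_setD1 W) //= => /linear_factor_prod[|W' W'S' eWW'].
  by rewrite polyC_eq0.
exists W' => //; move: eWW'; rewrite mulrC !mul_polyC.
case/(chain_poly_proportional ltTk) => // eW'W _.
have eK := Klinear_Kequiv (Klinear_chain_poly T rat k).
split; first exact: Kequiv_sym.
have [] // := chain_poly_proportional (b := 1) (c := 1) ltTk (oner_neq0 rat)
  (U := cover S :\: W) (V := cover S' :\: W').
rewrite !scale1r !cover_setD //; apply: (mulfI (chain_poly_neq0 rat W ltTk)).
rewrite -{2}(eK _ _ eW'W) -!multK; try exact: indep_cover.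
by rewrite -!cover_setD1 //; apply: eK.
Qed.

End MatchingComponents.

Section OrdinalSums.
Context (d : Order.disp_t) (T : finPOrderType d).
Implicit Types (U V A B J W I : {set T}) (x y : T).

Definition ideals_of_size U m := [set J | ideal U J && (#|J| == m)].

Lemma exists_ideal_between U I J m :
  ideal U I -> ideal U J -> I \subset J -> (#|I| <= m <= #|J|)%N ->
  exists W, [/\ W \in ideals_of_size U m, I \subset W & W \subset J].
Proof.
move=> idI idJ sIJ /andP[leIm lemJ]; have [n ltmI] := ubnP (m - #|I|)%N.
elim: n => // n IHn in I idI sIJ leIm ltmI *; have [eIm|nIm] := eqVneq #|I| m.
  by exists I; rewrite inE idI eIm eqxx.
have ltIm : (#|I| < m)%N by rewrite ltn_neqAle nIm.
have /properP[_ [x xJ xI]] : I \proper J by rewrite properEcard sIJ (leq_trans ltIm).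
have xUI : x \in U :\: I by rewrite inE xI (subsetP (ideal_sub idJ)).
have [z minz lezx] := exists_minimal_le xUI.
have /minimalsP[/setDP[zU zI] _] := minz.
have zJ : z \in J by have /idealP[_ clJ] := idJ; apply: (clJ x).
have idIz : ideal U (I :|: [set z]).
  apply: idealU => //; have : [set z] \subset minimals (U :\: I) by rewrite sub1set.
  by rewrite -ideal_antichain => /andP[].
have cIz : #|I :|: [set z]| = #|I|.+1 by rewrite setUC cardsU1 zI.
have [|||W [uW sIzW sWJ]] := IHn (I :|: [set z]) idIz; rewrite ?cIz //.
- by rewrite subUset sIJ sub1set.
- by rewrite subnS -ltnS prednK ?subn_gt0.
by exists W; split=> //; apply: subset_trans (subsetUl _ _) sIzW.
Qed.

Lemma ordsum_ideals_of_size A B : ordsum A B -> ideals_of_size (A :|: B) #|A| = [set A].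
Proof.
move=> AB; apply/setP => J; rewrite !inE; apply/andP/eqP => [[idJ /eqP cJ]|->]; last first.
  split=> //; apply/idealP; split=> [|x y xA]; first exact: subsetUl.
  by rewrite inE => /orP[//|yB]; rewrite (lt_geF (AB x y xA yB)).
have [sJA|/subsetPn[b bJ bA]] := boolP (J \subset A).
  by apply/eqP; rewrite eqEcard sJA cJ leqnn.
have /idealP[sJ clJ] := idJ.
have bB : b \in B by have := subsetP sJ b bJ; rewrite inE (negPf bA).
suff /proper_card : A \proper J by rewrite cJ ltnn.
apply/properP; split; last by exists b.
by apply/subsetP => a aA; apply: (clJ b); rewrite // ?inE ?aA // ltW // AB.
Qed.

(* If [x] is not below [y], an ideal of size [#|J|] can be found inside the ideal of
   the elements not above [x], or containing it: in the first case it misses [x], in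
   the second case it contains [y]. *)
Lemma ideals_of_size_ordsum U J : ideals_of_size U #|J| = [set J] -> ordsum J (U :\: J).
Proof.
move=> uJ; have := set11 J; rewrite -uJ inE => /andP[idJ _].
have leJU := subset_leq_card (ideal_sub idJ).
move=> x y xJ /setDP[yU yJ].
rewrite lt_neqAle; apply/andP; split; first by apply: contraNneq yJ => <-.
apply/negPn/negP => nlexy; pose V := [set z in U | ~~ (x <= z)%O].
have idV : ideal U V.
  apply/idealP; split=> [|v z]; first by apply/subsetP => z; rewrite inE => /andP[].
  by rewrite !inE => /andP[_ nlexv] -> lezv; apply: contra nlexv => /le_trans->.
have [leJV|ltVJ] := leqP #|J| #|V|.
  have [|W [+ _ sWV]] := exists_ideal_between (ideal_set0 U) idV (sub0set V) (m := #|J|).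
    by rewrite cards0.
  rewrite uJ => /set1P eWJ; have := subsetP sWV x.
  by rewrite eWJ xJ !inE lexx andbF => /(_ isT).
have [|W [+ sVW _]] := exists_ideal_between idV (ideal_refl U) (ideal_sub idV) (m := #|J|).
  by rewrite (ltnW ltVJ).
rewrite uJ => /set1P eWJ; have := subsetP sVW y.
by rewrite eWJ (negPf yJ) !inE yU nlexy => /(_ isT).
Qed.

Lemma nchains_card_ideals U m : (m <= #|U|)%N ->
  nchains [:: m; (#|U| - m)%N] U = #|ideals_of_size U m|%:R.
Proof.
move=> lemU; rewrite nchains_cons -sum1dep_card natr_sum; apply: eq_bigr => J /andP[idJ /eqP cJ].
by rewrite nchains_seq1 cards_setD_ideal // cJ eqxx.
Qed.

Lemma Kequiv_card_ideals U V m : Kequiv U V -> (m <= #|U|)%N ->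
  #|ideals_of_size U m| = #|ideals_of_size V m|.
Proof.
move=> eUV lemU; have cUV := Kequiv_card eUV; apply/eqP.
by rewrite -(eqr_nat int) -!nchains_card_ideals -?cUV // eUV.
Qed.

Lemma nchains_unique_idealr U J a : ideals_of_size U #|J| = [set J] ->
  nchains (#|J| :: a) U = nchains a (U :\: J).
Proof.
move=> uJ; rewrite nchains_cons; apply: big_pred1 => W.
by have /setP/(_ W) := uJ; rewrite !inE.
Qed.

Lemma nchains_unique_ideall U J a : ideals_of_size U #|J| = [set J] ->
  sumn a = #|J| -> nchains (rcons a (#|U| - #|J|)%N) U = nchains a J.
Proof.
move=> uJ sa; have := set11 J; rewrite -uJ inE => /andP[idJ _].
rewrite nchains_rcons (bigD1 J) /= ?idJ ?cards_setD_ideal ?eqxx //.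
rewrite big1 ?addr0 // => W /andP[/andP[idW _] nW]; apply: nchains_eq0; rewrite sa.
by apply: contra nW => cW; have /setP/(_ W) := uJ; rewrite !inE idW cW => <-.
Qed.

Lemma Kequiv_unique_ideal U V J : ideals_of_size U #|J| = [set J] -> Kequiv U V ->
  exists J', [/\ ideals_of_size V #|J'| = [set J'], Kequiv J J' &
                 Kequiv (U :\: J) (V :\: J')].
Proof.
move=> uJ eUV; have cUV := Kequiv_card eUV.
have leJU : (#|J| <= #|U|)%N.
  by have := set11 J; rewrite -uJ inE => /andP[/ideal_sub/subset_leq_card].
have /eqP/cards1P[J' uJ'] : #|ideals_of_size V #|J| | = 1%N.
  by rewrite -(Kequiv_card_ideals eUV) // uJ cards1.
have cJ' : #|J'| = #|J| by have := set11 J'; rewrite -uJ' inE => /andP[_ /eqP].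
rewrite -cJ' in uJ'; exists J'; split=> // a.
  have [sa|na] := eqVneq #|J| (sumn a); last by rewrite !nchains_eq0 ?cJ'.
  rewrite -(nchains_unique_ideall uJ) // -(nchains_unique_ideall uJ') ?cJ' //.
  by rewrite eUV cUV.
by rewrite -(nchains_unique_idealr a uJ) eUV -cJ' nchains_unique_idealr.
Qed.

End OrdinalSums.

Section Isomorphisms.
Context (d : Order.disp_t) (T : finPOrderType d).
Implicit Types (U V A B W X Y : {set T}) (S : {set {set T}}).

Definition set_iso U V :=
  exists2 f : T -> T, f @: U = V & {in U &, {mono f : x y / (x <= y)%O}}.

Lemma set_iso_setU A B A' B' : [disjoint A & B] ->
  (forall x y x' y', x \in A -> y \in B -> x' \in A' -> y' \in B' ->
     (x' <= y')%O = (x <= y)%O /\ (y' <= x')%O = (y <= x)%O) ->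
  set_iso A A' -> set_iso B B' -> set_iso (A :|: B) (A' :|: B').
Proof.
move=> dAB eqAB [f fA mf] [g gB mg]; pose h x := if x \in A then f x else g x.
have hA : {in A, h =1 f} by move=> x xA; rewrite /h xA.
have hB : {in B, h =1 g} by move=> x xB; rewrite /h (disjointFl dAB).
have fgE x y : x \in A -> y \in B ->
    (f x <= g y)%O = (x <= y)%O /\ (g y <= f x)%O = (y <= x)%O.
  by move=> xA yB; apply: eqAB; rewrite -?fA -?gB ?imset_f.
exists h; first by rewrite imsetU (eq_in_imset hA) (eq_in_imset hB) fA gB.
move=> x y; rewrite !inE => /orP[xA|xB] /orP[yA|yB].
- by rewrite !hA // mf.
- by rewrite (hA x xA) (hB y yB); case: (fgE x y xA yB).
- by rewrite (hB x xB) (hA y yA); case: (fgE y x yA xB).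
- by rewrite !hB // mg.
Qed.

Lemma ordsum_disjoint A B : ordsum A B -> [disjoint A & B].
Proof.
move=> AB; apply/pred0P => x; apply: contraTF isT => /andP[xA xB].
by have := AB x x xA xB; rewrite ltxx.
Qed.

Lemma set_iso_indep A B A' B' : indep A B -> indep A' B' ->
  set_iso A A' -> set_iso B B' -> set_iso (A :|: B) (A' :|: B').
Proof.
move=> AB AB'; apply: set_iso_setU (indep_disjoint AB) _ => x y x' y' xA yB xA' yB'.
by rewrite !(indep_leF AB xA yB) !(indep_leF AB' xA' yB').
Qed.

Lemma set_iso_ordsum A B A' B' : ordsum A B -> ordsum A' B' ->
  set_iso A A' -> set_iso B B' -> set_iso (A :|: B) (A' :|: B').
Proof.
move=> AB AB'; apply: set_iso_setU (ordsum_disjoint AB) _ => x y x' y' xA yB xA' yB'.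
have [ltxy ltxy'] := (AB x y xA yB, AB' x' y' xA' yB').
by rewrite (ltW ltxy) (ltW ltxy') (lt_geF ltxy) (lt_geF ltxy').
Qed.

Inductive series_parallel_set : {set T} -> Prop :=
  | series_parallel_set1 x : series_parallel_set [set x]
  | series_parallel_setU A B :
      series_parallel_set A -> series_parallel_set B -> indep A B \/ ordsum A B ->
      series_parallel_set (A :|: B).

Lemma series_parallel_set_neq0 U : series_parallel_set U -> U != set0.
Proof.
elim=> [x|A B _ nA _ _ _]; first by apply/set0Pn; exists x; rewrite inE.
by rewrite setU_eq0 (negPf nA).
Qed.

Lemma series_parallel_set_sub U W :
  series_parallel_set U -> W \subset U -> W != set0 -> series_parallel_set W.
Proof.
move=> spU; elim: spU W => [x|A B _ IHA _ IHB AB] W.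
  by rewrite subset1 => /orP[/eqP->|/eqP->]; [constructor|rewrite eqxx].
move=> /setIidPl; rewrite setIUr => <-.
have [->|nA] := eqVneq (W :&: A) set0.
  by rewrite set0U; apply: IHB; apply: subsetIr.
have [->|nB] := eqVneq (W :&: B) set0.
  by rewrite setU0 => _; apply: IHA => //; apply: subsetIr.
move=> _; constructor; [by apply: IHA; rewrite ?subsetIr|by apply: IHB; rewrite ?subsetIr|].
by case: AB => AB; [left|right]; apply: sub_in11 AB => x /setIP[].
Qed.

Lemma apex_decomposition_setU S S' :
  apex_decomposition S -> apex_decomposition S' -> indep (cover S) (cover S') ->
  apex_decomposition (S :|: S').
Proof.
move=> [iS aS] [iS' aS'] SS'; split=> [A B|A]; last by case/setUP => [/aS|/aS'].
have cross A' B' : A' \in S -> B' \in S' -> indep A' B'.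
  by move=> A'S B'S'; apply: indep_sub SS'; apply: bigcup_sup.
case/setUP=> AS /setUP[BS|BS] nAB; first exact: iS.
- exact: cross.
- exact/indep_sym/cross.
- exact: iS'.
Qed.

Lemma series_parallel_set_decomposition U :
  series_parallel_set U -> exists2 S, apex_decomposition S & cover S = U.
Proof.
have singleton W : apexes W != set0 -> exists2 S, apex_decomposition S & cover S = W.
  move=> aW; exists [set W]; last by rewrite /cover big_set1.
  by split=> [A B|A]; rewrite !inE => /eqP-> // /eqP->; rewrite eqxx.
elim=> [x|A B spA [S dS eA] spB [S' dS' eB] [AB|AB]].
- by apply: singleton; rewrite apexes_set1; apply/set0Pn; exists x; rewrite inE.
- exists (S :|: S'); first by apply: apex_decomposition_setU; rewrite // eA eB.
  by rewrite -eA -eB /cover bigcup_setU.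
- apply: singleton; have /set0Pn[b bB] := series_parallel_set_neq0 spB; apply/set0Pn.
  by exists b; apply: (subsetP (sub_apexes_ordsum (series_parallel_set_neq0 spA) AB)).
Qed.

Variant Kequiv_split U V : Prop :=
  KequivSplit X Y X' Y' of
    U = X :|: Y & V = X' :|: Y' & X != set0 & Y != set0 & Kequiv X X' & Kequiv Y Y'
    & indep X Y /\ indep X' Y' \/ ordsum X Y /\ ordsum X' Y'.

Lemma Kequiv_split_sym U V : Kequiv_split U V -> Kequiv_split V U.
Proof.
case=> X Y X' Y' -> -> nX nY eX eY rel.
apply: (@KequivSplit _ _ X' Y' X Y) => //.
- by rewrite -(Kequiv_eq0 eX).
- by rewrite -(Kequiv_eq0 eY).
by case: rel => -[]; [left|right].
Qed.

Lemma Kequiv_split_ordsum A B V : A != set0 -> B != set0 -> ordsum A B ->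
  Kequiv (A :|: B) V -> Kequiv_split (A :|: B) V.
Proof.
move=> nA nB AB eV; have uA := ordsum_ideals_of_size AB.
have [J [uJ eA]] := Kequiv_unique_ideal uA eV.
rewrite setDUl setDv set0U (setDidPl _) 1?disjoint_sym ?ordsum_disjoint // => eB.
have sJV : J \subset V by have := set11 J; rewrite -uJ inE => /andP[/ideal_sub].
apply: (@KequivSplit _ _ A B J (V :\: J)) => //.
  by rewrite -{1}(setIidPr sJV) setID.
by right; split=> //; apply: ideals_of_size_ordsum.
Qed.

Lemma Kequiv_split_component S S' W :
  apex_decomposition S -> apex_decomposition S' -> apexes (cover S) = set0 ->
  {in S, forall X, #|X| <= #|W|}%N -> {in S', forall X, #|X| <= #|W|}%N -> W \in S ->
  Kequiv (cover S) (cover S') -> Kequiv_split (cover S) (cover S').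
Proof.
move=> dS [iS' _] aS0 leS leS' WS eSS'; have [iS aS] := dS.
have [W' W'S' [eW]] := exists_Kequiv_component dS iS' leS leS' WS eSS'.
rewrite !cover_setD // => eD.
have iW := indep_cover iS WS; have iW' := indep_cover iS' W'S'.
apply: (@KequivSplit _ _ W (cover (S :\ W)) W' (cover (S' :\ W'))) => //.
- exact: cover_setD1.
- exact: cover_setD1.
- by apply: contraNneq (aS W WS) => ->; apply/eqP/setP => x; rewrite !inE.
- by apply: contraNneq (aS W WS) => e0; rewrite -aS0 (cover_setD1 WS) e0 setU0.
by left.
Qed.

Lemma Kequiv_split_indep A B V : A != set0 -> B != set0 -> indep A B ->
  series_parallel_set (A :|: B) -> series_parallel_set V ->
  Kequiv (A :|: B) V -> Kequiv_split (A :|: B) V.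
Proof.
move=> nA nB AB spU spV; have aU0 := apexes_indep AB nA nB.
have [S dS eU] := series_parallel_set_decomposition spU.
have [S' dS' <-] := series_parallel_set_decomposition spV.
rewrite -eU in aU0 *; move=> eSS'.
have aV0 : apexes (cover S') = set0 by apply/eqP; rewrite -(Kequiv_apexes_eq0 eSS') aU0.
have [W0 W0SS'] : exists W, W \in S :|: S'.
  have /set0Pn[x] := series_parallel_set_neq0 spU; rewrite -eU => /bigcupP[W WS _].
  by exists W; rewrite inE WS.
have [W WSS' maxW] := arg_maxnP (fun W : {set T} => #|W|) W0SS'.
have leS : {in S, forall X, #|X| <= #|W|}%N by move=> X XS; apply/maxW/setUP; left.
have leS' : {in S', forall X, #|X| <= #|W|}%N by move=> X XS'; apply/maxW/setUP; right.
have /setUP[WS|WS'] : W \in S :|: S' := WSS'; first exact: (Kequiv_split_component (W := W)).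
by apply/Kequiv_split_sym/(Kequiv_split_component (W := W)) => //; apply: Kequiv_sym.
Qed.

Lemma Kequiv_split_series_parallel U V : series_parallel_set U -> series_parallel_set V ->
  Kequiv U V -> (1 < #|U|)%N -> Kequiv_split U V.
Proof.
move=> spU spV; case: spU (spU) => [x|A B spA spB AB] spU eUV; first by rewrite cards1.
have [nA nB] := (series_parallel_set_neq0 spA, series_parallel_set_neq0 spB).
by move=> _; case: AB => AB; [apply: Kequiv_split_indep|apply: Kequiv_split_ordsum].
Qed.

Lemma set_iso_set1 x y : set_iso [set x] [set y].
Proof.
exists (fun=> y); first by rewrite imset_set1.
by move=> z t /set1P-> /set1P->; rewrite !lexx.
Qed.

Lemma series_parallel_set_iso U V :
  series_parallel_set U -> series_parallel_set V -> Kequiv U V -> set_iso U V.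
Proof.
have [n] := ubnP #|U|; elim: n => // n IHn in U V * => /ltnSE-leUn spU spV eUV.
have [leU1|ltU1] := leqP #|U| 1.
  have U1 : #|U| == 1%N by rewrite eqn_leq leU1 card_gt0 series_parallel_set_neq0.
  have V1 : #|V| == 1%N by rewrite -(Kequiv_card eUV).
  by have [[x ->] [y ->]] := (cards1P U1, cards1P V1); apply: set_iso_set1.
have [X Y X' Y' eU eV nX nY eX eY rel] := Kequiv_split_series_parallel spU spV eUV ltU1.
have dXY : [disjoint X & Y].
  by case: rel => -[rel _]; [apply: indep_disjoint|apply: ordsum_disjoint].
have cU : #|U| = (#|X| + #|Y|)%N by apply/eqP; rewrite eU leq_card_setU.
have [nX' nY'] : X' != set0 /\ Y' != set0 by rewrite -(Kequiv_eq0 eX) -(Kequiv_eq0 eY).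
have isoX : set_iso X X'.
  apply: IHn => //; first by rewrite (leq_trans _ leUn) // cU -addn1 leq_add2l card_gt0.
    by apply: series_parallel_set_sub spU _ nX; rewrite eU subsetUl.
  by apply: series_parallel_set_sub spV _ nX'; rewrite eV subsetUl.
have isoY : set_iso Y Y'.
  apply: IHn => //; first by rewrite (leq_trans _ leUn) // cU -add1n leq_add2r card_gt0.
    by apply: series_parallel_set_sub spU _ nY; rewrite eU subsetUr.
  by apply: series_parallel_set_sub spV _ nY'; rewrite eV subsetUr.
by rewrite eU eV; case: rel => -[relXY relXY']; [apply: set_iso_indep|apply: set_iso_ordsum].
Qed.

End Isomorphisms.

Lemma ideal_imset (dP dT : Order.disp_t) (P : finPOrderType dP) (T : finPOrderType dT)
    (f : P -> T) (U J : {set P}) : injective f -> {mono f : x y / (x <= y)%O} ->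
  ideal (f @: U) (f @: J) = ideal U J.
Proof.
move=> injf mf; apply/idealP/idealP => -[sJU clJ]; split.
- by apply/subsetP => x xJ; rewrite -(mem_imset U x injf) (subsetP sJU) ?imset_f.
- move=> x y xJ yU leyx; rewrite -(mem_imset J y injf).
  by apply: (clJ (f x)); rewrite ?imset_f ?mf.
- exact: imsetS.
- move=> _ _ /imsetP[x xJ ->] /imsetP[y yU ->]; rewrite mf => leyx.
  by rewrite imset_f // (clJ x).
Qed.

Lemma imsetD_inj (aT rT : finType) (f : aT -> rT) (A B : {set aT}) :
  injective f -> f @: (A :\: B) = f @: A :\: f @: B.
Proof.
move=> injf; apply/setP => y; apply/imsetP/setDP.
  by case=> x /setDP[xA xB] ->; rewrite !mem_imset.
case=> /imsetP[x xA ->]; rewrite mem_imset // => xB.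
by exists x; rewrite // inE xB.
Qed.

Lemma nchains_imset (dP dT : Order.disp_t) (P : finPOrderType dP) (T : finPOrderType dT)
    (f : P -> T) a (U : {set P}) : {mono f : x y / (x <= y)%O} ->
  nchains a (f @: U) = nchains a U.
Proof.
move=> mf; have injf := inc_inj mf.
elim: a U => [|m a IHa] U; first by rewrite !nchains_nil imset_eq0.
rewrite !nchains_cons (reindex_onto (fun J : {set P} => f @: J) (fun J => f @^-1: J)) /=.
  apply: eq_big => [J|J _]; last by rewrite -imsetD_inj.
  rewrite card_imset // ideal_imset //; have -> : f @^-1: (f @: J) == J.
    by apply/eqP/setP => x; rewrite inE mem_imset.
  by rewrite andbT.
move=> J /andP[/ideal_sub/subsetP sJ _]; apply/setP => y; apply/imsetP/idP => [[x]|yJ].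
  by rewrite inE => fxJ ->.
by have /imsetP[x _ ey] := sJ y yJ; exists x; rewrite // inE -ey.
Qed.

Lemma imset_sum (aT bT rT : finType) (f : aT + bT -> rT) :
  f @: setT = (f \o inl) @: setT :|: (f \o inr) @: setT.
Proof.
apply/setP => y; apply/imsetP/setUP => [[[x|x] _ ->]|]; [left|right|]; try exact: imset_f.
by case=> /imsetP[x _ ->]; [exists (inl x)|exists (inr x)].
Qed.

Lemma series_parallel_imset (d : Order.disp_t) (P : finPOrderType d) :
  series_parallel P -> forall (dT : Order.disp_t) (T : finPOrderType dT) (f : P -> T),
  {mono f : x y / (x <= y)%O} -> series_parallel_set (f @: [set: P]).
Proof.
elim=> {d P} [d P P1|dP dQ P Q _ IHP _ IHQ|dP dQ P Q _ IHP _ IHQ|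
    dP dQ P Q _ IHP [g [h gK hK] mg]] dT T f mf.
- have /eqP/cards1P[x ->] : #|[set: P]| = 1%N by rewrite cardsT.
  by rewrite imset_set1; constructor.
- rewrite imset_sum; constructor.
  + by apply: IHP => x y /=; rewrite mf.
  + by apply: IHQ => x y /=; rewrite mf.
  + by left=> _ _ /imsetP[x _ ->] /imsetP[y _ ->]; rewrite /Order.comparable !mf.
- rewrite imset_sum; constructor.
  + by apply: IHP => x y /=; rewrite mf.
  + by apply: IHQ => x y /=; rewrite mf.
  + by right=> _ _ /imsetP[x _ ->] /imsetP[y _ ->]; rewrite lt_leAnge !mf.
- have -> : f @: [set: Q] = (f \o g) @: [set: P].
    apply/setP => y; apply/imsetP/imsetP => -[x _ ->]; last by exists (g x).
    by exists (h x); rewrite //= hK.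
  by apply: IHP => x y /=; rewrite mf mg.
Qed.

Lemma set_iso_poset_iso (dP dQ dT : Order.disp_t) (P : finPOrderType dP)
    (Q : finPOrderType dQ) (T : finPOrderType dT) (f : P -> T) (g : Q -> T) :
  {mono f : x y / (x <= y)%O} -> {mono g : x y / (x <= y)%O} ->
  set_iso (f @: [set: P]) (g @: [set: Q]) -> poset_iso P Q.
Proof.
move=> mf mg [h hfg mh].
have /fin_all_exists[k kE] x : exists y, h (f x) = g y.
  have : h (f x) \in g @: setT by rewrite -hfg !imset_f.
  by case/imsetP=> y _ ->; exists y.
have mk : {mono k : x y / (x <= y)%O}.
  by move=> x y; rewrite -mg -!kE mh ?imset_f // mf.
exists k => //; have /fin_all_exists[k' k'E] y : exists x, k x = y.
  have : g y \in h @: (f @: setT) by rewrite hfg imset_f.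
  case/imsetP=> _ /imsetP[x _ ->]; rewrite kE => /(inc_inj mg)->.
  by exists x.
by exists k' => // x; apply/(inc_inj mk).
Qed.

Section PPartitions.
Context (d : Order.disp_t) (P : finPOrderType d).
Implicit Types (U J : {set P}) (h : P -> nat) (a : seq nat).

(* Extending the [P]-partitions of [U] by 0 lets [predn] remove their lowest level. *)
Definition Ppartition_on U a h : Prop :=
  [/\ forall x, (0 < h x)%N = (x \in U),
      {in U &, {homo h : x y / (x <= y)%O >-> (x <= y)%N}}
    & forall i, #|[set x | h x == i.+1]| = nth 0%N a i].

Lemma Ppartition_on_le_size U a h : Ppartition_on U a h -> forall x, (h x <= size a)%N.
Proof.
case=> _ _ fib x; rewrite leqNgt; apply/negP => lt_size.
have := fib (h x).-1; rewrite prednK ?(leq_ltn_trans _ lt_size) //.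
rewrite nth_default -1?ltnS ?prednK ?(leq_ltn_trans _ lt_size) // => /card0_eq/(_ x).
by rewrite !inE eqxx.
Qed.

Lemma Ppartition_on_nil U h : Ppartition_on U [::] h <-> U = set0 /\ forall x, h x = 0%N.
Proof.
split=> [hU|[-> h0]]; last first.
  split=> [x|x y|i]; rewrite ?inE ?h0 // nth_nil; apply: eq_card0 => x.
  by rewrite !inE h0.
have h0 x : h x = 0%N by apply/eqP; rewrite -leqn0 (Ppartition_on_le_size hU x).
by split=> //; have [supp _ _] := hU; apply/setP => x; rewrite -supp h0 inE.
Qed.

Lemma Ppartition_on_cons U m a h (J := [set x | h x == 1%N]) :
  Ppartition_on U (m :: a) h <->
  [/\ forall x, (0 < h x)%N = (x \in U), ideal U J, #|J| = m
    & Ppartition_on (U :\: J) a (predn \o h)].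
Proof.
have fibS i : [set x | (h x).-1 == i.+1] = [set x | h x == i.+2].
  by apply/setP => x; rewrite !inE; case: (h x).
split=> [[supp mono_h fib]|[supp idJ cJ [_ mono_h fib]]].
  split=> //.
  - apply/idealP; split=> [|x y]; first by apply/subsetP => x; rewrite inE -supp => /eqP->.
    rewrite !inE => /eqP hx yU leyx; rewrite eqn_leq supp yU andbT -hx.
    by apply: mono_h; rewrite // -supp hx.
  - exact: fib 0%N.
  split=> [x|x y /setDP[xU _] /setDP[yU _] lexy|i].
  - by rewrite !inE -supp /=; case: (h x) => [|[]].
  - by rewrite /= -!subn1 leq_sub2r ?mono_h.
  - by rewrite fibS (fib i.+1).
split=> // [x y xU yU lexy|[|i]]; last 2 first.
- exact: cJ.
- by rewrite -fibS fib.
have [yJ|yJ] := boolP (y \in J).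
  have xJ : x \in J by have /idealP[_ clJ] := idJ; apply: (clJ y).
  by move: xJ yJ; rewrite !inE => /eqP-> /eqP->.
have hy_gt0 : (0 < h y)%N by rewrite supp.
have [|xJ] := boolP (x \in J); first by rewrite inE => /eqP->.
have : ((h x).-1 <= (h y).-1)%N by apply: mono_h; rewrite // inE ?xJ ?yJ.
by rewrite -ltnS !prednK // supp.
Qed.

Section Counting.
Context (n : nat).
Implicit Types theta : {ffun P -> 'I_n.+1}.

Definition Ppartitions U a :=
  [set theta : {ffun P -> 'I_n.+1} | `[< Ppartition_on U a (fun x => theta x) >]].

Lemma card_Ppartitions_nil U : #|Ppartitions U [::]|%:R = nchains [::] U.
Proof.
rewrite nchains_nil; have [->|/eqP nU] := eqVneq U set0; last first.
  by rewrite eq_card0 // => theta; rewrite inE; apply/asboolP => /Ppartition_on_nil[].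
rewrite (_ : Ppartitions _ _ = [set [ffun=> ord0]]) ?cards1 //; apply/setP => theta.
rewrite !inE; apply/asboolP/eqP => [/Ppartition_on_nil[_ theta0]|->].
  by apply/ffunP => x; rewrite ffunE; apply/val_inj/theta0.
by apply/Ppartition_on_nil; split=> // x; rewrite ffunE.
Qed.

Definition lower theta : {ffun P -> 'I_n.+1} := [ffun x => inord (theta x).-1].

Definition raise U theta : {ffun P -> 'I_n.+1} :=
  [ffun x => if x \in U then inord (theta x).+1 else ord0].

Lemma val_lower theta x : lower theta x = (theta x).-1 :> nat.
Proof. by rewrite ffunE inordK // (leq_ltn_trans (leq_pred _)). Qed.

Lemma val_raise U V a theta x : (size a < n)%N -> theta \in Ppartitions V a ->
  raise U theta x = (if x \in U then (theta x).+1 else 0%N) :> nat.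
Proof.
move=> lt_an; rewrite inE ffunE => /asboolP/Ppartition_on_le_size/(_ x) le_a.
by case: ifP => // _; rewrite inordK // ltnS (leq_ltn_trans le_a).
Qed.

Lemma lowerK U m a theta : theta \in Ppartitions U (m :: a) -> raise U (lower theta) = theta.
Proof.
rewrite inE => /asboolP[supp _ _]; apply/ffunP => x; apply: ord_inj; rewrite ffunE.
rewrite val_lower -supp; case: posnP => [/esym //|theta_gt0].
by rewrite prednK // inord_val.
Qed.

Lemma raise_Ppartitions U J a theta : (size a < n)%N -> ideal U J ->
  [&& raise U theta \in Ppartitions U (#|J| :: a),
      [set x | raise U theta x == 1%N :> nat] == J & lower (raise U theta) == theta] =
  (theta \in Ppartitions (U :\: J) a).
Proof.
move=> lt_an idJ; apply/and3P/idP => [[+ /eqP fibJ /eqP raiseK]|thetaP].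
  rewrite !inE => /asboolP/Ppartition_on_cons[_ _ _]; rewrite fibJ => tailP.
  apply/asboolP; rewrite -raiseK; move: tailP; congr Ppartition_on.
  by apply/funext => x; rewrite val_lower.
have raiseE x := val_raise U x lt_an thetaP.
have /asboolP thetaP' : `[< Ppartition_on (U :\: J) a (fun x => theta x) >].
  by move: thetaP; rewrite inE.
have [supp _ _] := thetaP'.
have predE x : (raise U theta x).-1 = theta x.
  rewrite raiseE; case: ifPn => // xU; apply/esym/eqP.
  by rewrite -leqn0 leqNgt supp inE (negPf xU) andbF.
have fibJ : [set x | raise U theta x == 1%N :> nat] = J.
  apply/setP => x; rewrite inE raiseE; case: ifPn => xU; last first.
    by apply/esym/(contraNF _ xU)/subsetP/ideal_sub.
  by rewrite eqSS -leqn0 leqNgt supp inE xU andbT negbK.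
split; last 2 first.
- exact/eqP.
- by apply/eqP/ffunP => x; apply: ord_inj; rewrite val_lower predE.
rewrite inE; apply/asboolP/Ppartition_on_cons; rewrite fibJ; split=> // [x|].
  by rewrite raiseE; case: (x \in U).
by rewrite (_ : predn \o _ = fun x => theta x : nat) //; apply/funext => x; apply: predE.
Qed.

Lemma card_Ppartitions U a : (size a <= n)%N -> #|Ppartitions U a|%:R = nchains a U.
Proof.
elim: a U => [|m a IHa] U lt_an; first exact: card_Ppartitions_nil.
pose fib theta := [set x | theta x == 1%N :> nat].
rewrite nchains_cons -sum1_card natr_sum.
rewrite (partition_big fib (fun J => ideal U J && (#|J| == m))) /=; last first.
  by move=> theta; rewrite inE => /asboolP/Ppartition_on_cons[_ -> -> _]; rewrite eqxx.
apply: eq_bigr => J /andP[idJ /eqP cJ]; rewrite -IHa; last exact: ltnW.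
rewrite -sum1_card natr_sum (reindex_onto (raise U) lower) /=; last first.
  by move=> theta /andP[/lowerK].
by apply: eq_bigl => theta; rewrite -cJ -andbA raise_Ppartitions.
Qed.

End Counting.
End PPartitions.

Definition composition_monomial (a : seq nat) : monomial :=
  [fsfun i in [fset i in iota 1 (size a)]%fset => nth 0%N a i.-1 | 0%N].

Lemma composition_monomialE a i :
  composition_monomial a i = if i is i'.+1 then nth 0%N a i' else 0%N.
Proof.
rewrite fsfunE !finmap.inE /= mem_iota; case: i => [|i] //=.
by rewrite add1n ltnS; case: ltnP => // lei; rewrite nth_default.
Qed.

Lemma is_Ppartition_on_setT (d : Order.disp_t) (P : finPOrderType d) a
    (theta : {ffun P -> nat}) :
  is_Ppartition theta /\ Ppart_monomial theta = composition_monomial a <->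
  Ppartition_on [set: P] a theta.
Proof.
split=> [[[theta_gt0 mono_theta] /fsfunP eqm]|[supp mono_theta fib]].
  split=> [x|x y _ _|i]; [by rewrite theta_gt0 inE|exact: mono_theta|].
  by have := eqm i.+1; rewrite composition_monomialE Ppart_monomialE cardsE.
split; first by split=> [x|x y lexy]; [rewrite supp inE|apply: mono_theta; rewrite ?inE].
apply/fsfunP => -[|i]; rewrite Ppart_monomialE composition_monomialE.
  by apply: eq_card0 => x; rewrite !inE; apply/negbTE; rewrite -lt0n supp inE.
by rewrite -fib cardsE.
Qed.

Lemma K_composition_monomial (d : Order.disp_t) (P : finPOrderType d) a :
  K P (composition_monomial a) = nchains a [set: P].
Proof.
rewrite KE; set A := (X in fset_set X).
have finA : finite_set A.
  by apply: (sub_finite_set _ (@K_finite _ P (composition_monomial a))) => theta [].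
pose n := size a; pose to_nat (theta : {ffun P -> 'I_n.+1}) := [ffun x => theta x : nat].
have to_natE theta : to_nat theta = (fun x => theta x : nat) :> (P -> nat).
  by apply/funext => x; rewrite ffunE.
have to_nat_inj : injective to_nat.
  by move=> t1 t2 /ffunP e; apply/ffunP => x; apply/val_inj; have := e x; rewrite !ffunE.
rewrite -(card_Ppartitions [set: P] (leqnn n)) natz; congr Posz.
suff -> : fset_set A = [fset to_nat theta | theta in Ppartitions n [set: P] a]%fset.
  by rewrite card_imfset //= -cardE.
apply/fsetP => theta; rewrite in_fset_set //; apply/idP/imfsetP => /= [|[theta' + ->]].
  move=> /set_mem/is_Ppartition_on_setT thetaP.
  have le_n x : (theta x < n.+1)%N by rewrite ltnS; apply: Ppartition_on_le_size thetaP x.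
  have thetaE : theta = to_nat [ffun x => Ordinal (le_n x)].
    by apply/ffunP => x; rewrite !ffunE.
  exists [ffun x => Ordinal (le_n x)] => //.
  by rewrite inE -to_natE -thetaE; apply/asboolP.
rewrite inE -to_natE => /asboolP thetaP.
exact/classical_sets.mem_set/is_Ppartition_on_setT.
Qed.

Theorem theorem5p2 (dP dQ : Order.disp_t)
    (P : finPOrderType dP) (Q : finPOrderType dQ)
    (spP : series_parallel P) (spQ : series_parallel Q)
    (eqK : K P = K Q) :
  poset_iso P Q.
Proof.
have mono_inl : {mono (inl : P -> disj_union P Q) : x y / (x <= y)%O} by [].
have mono_inr : {mono (inr : Q -> disj_union P Q) : x y / (x <= y)%O} by [].
apply: (set_iso_poset_iso mono_inl mono_inr); apply: series_parallel_set_iso.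
- exact: series_parallel_imset.
- exact: series_parallel_imset.
by move=> a; rewrite !nchains_imset // -!K_composition_monomial eqK.
Qed.
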